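(* Let $(X,d)$ be a semimetric space and let $A$, $B$ be disjoint proximinal subsets of $(X,d)$ such that $X=A\cup B$. Let $G$ be the graph with $V(G)=X$ such that, for all distinct $x,y\in X$, $\{x,y\}\in E(G)$ if and only if $d(x,y)\le\operatorname{dist}(A,B)$. Then $G$ is path-bipartite for $A$ and $B$ if and only if the following two conditions are fulfilled: (i) For every $a\in A\setminus A_0$ there are a best proximity pair $(a^*,b^* )\in A\times B$ and a finite path $(a_1,\dots,a_n)\subseteq G[A]$ such that $a_1=a$ and $a_n=a^*$. (ii) For every $b\in B\setminus B_0$ there are a best proximity pair $(a^*,b^* )\in A\times B$ and a finite path $(b_1,\dots,b_n)\subseteq G[B]$ such that $b_1=b$ and $b_n=b^*$.
   Context: A semimetric on a nonempty set $X$ is a function $d\colon X\times X\to[0,\infty)$ with $d(x,y)=d(y,x)$ and $d(x,y)=0\Leftrightarrow x=y$ for all $x,y\in X$. A nonempty subset $A$ of $(X,d)$ is proximinal if for every $x\in X$ there is $a_0\in A$ with $d(x,a_0)=\inf\{d(x,a)\colon a\in A\}$. For nonempty $A,B\subseteq X$, $\operatorname{dist}(A,B):=\inf\{d(a,b)\colon a\in A,\ b\in B\}$; $A_0:=\{a\in A\colon d(a,b)=\operatorname{dist}(A,B)\text{ for some }b\in B\}$ and $B_0:=\{b\in B\colon d(a,b)=\operatorname{dist}(A,B)\text{ for some }a\in A\}$. A pair $(a^*,b^* )\in A_0\times B_0$ is a best proximity pair for $A$ and $B$ if $d(a^*,b^* )=\operatorname{dist}(A,B)$. Graphs are simple (no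 loops, no multiple edges) and may be infinite. $G[S]$ is the subgraph of $G$ induced by $S\subseteq V(G)$. A path is a finite graph $P$ whose (distinct) vertices can be numbered $u_0,\dots,u_k$, $k\ge 1$, so that $E(P)=\{\{u_0,u_1\},\dots,\{u_{k-1},u_k\}\}$; one writes $P=(u_0,\dots,u_k)$. Let $A,B$ be nonempty disjoint sets. A path $P$ is a be-path of $A$ and $B$ if $V(P)\subseteq A\cup B$ and there is exactly one edge $\{a_0,b_0\}\in E(P)$ meeting both $A$ and $B$. A graph $G$ with $A,B\subseteq V(G)$ is path-bipartite for $A$ and $B$ if $G$ is the union (of vertex sets and of edge sets) of a nonempty set of be-paths of $A$ and $B$. *)

(* Defs.v *)
From mathcomp Require Import all_boot all_order all_algebra.
From mathcomp Require Import all_classical all_reals.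

Set Implicit Arguments.
Unset Strict Implicit.
Unset Printing Implicit Defensive.

Import Order.TTheory GRing.Theory Num.Theory.

Local Open Scope classical_set_scope.
Local Open Scope ring_scope.

Section Semimetric.
Context {R : realType} {X : Type}.
Implicit Types (d : X -> X -> R) (A B : set X).

Definition is_semimetric d : Prop :=
  [/\ forall x y, 0 <= d x y,
      forall x y, d x y = d y x
    & forall x y, d x y = 0 <-> x = y].

Definition proximinal d A : Prop :=
  A !=set0 /\
  forall x, exists2 a0, A a0 & d x a0 = inf [set d x a | a in A].

(* A genuine infimum when A and B are nonempty and d is nonnegative; otherwise
   [inf] may return a default value. *)
Definition set_dist d A B : R := inf [set d a b | a in A & b in B].

Definition prox_left d A B : set X :=
  [set a | A a /\ exists2 b, B b & d a b = set_dist d A B].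

Definition prox_right d A B : set X :=
  [set b | B b /\ exists2 a, A a & d a b = set_dist d A B].

Definition best_proximity_pair d A B (a b : X) : Prop :=
  [/\ prox_left d A B a, prox_right d A B b & d a b = set_dist d A B].

End Semimetric.

(* Simple, possibly infinite graphs whose vertices lie in an ambient type;
   an edge is an unordered pair, i.e. a two-element set [set x; y]. *)
Record graph (T : Type) := Graph {
  vset : set T;
  eset : set (set T);
  eset_pair : forall e, eset e ->
    exists x y, [/\ vset x, vset y, x <> y & e = [set x; y]]
}.

Section Graphs.
Context {T : Type}.
Implicit Types (G H P : graph T) (S A B : set T).

Definition subgraph H G : Prop :=
  vset H `<=` vset G /\ eset H `<=` eset G.

Fact induced_eset_pair G S e : (eset G `&` [set f | f `<=` S]) e ->
  exists x y, [/\ (vset G `&` S) x, (vset G `&` S) y, x <> y & e = [set x; y]].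
Proof.
move=> [/eset_pair[x [y [Gx Gy xy ->]]] /= eS].
by exists x, y; split => //; split => //; apply: eS; [left|right].
Qed.

Definition induced G S : graph T := Graph (@induced_eset_pair G S).

(* P = (u 0, ..., u k); the values of u beyond k are irrelevant. *)
Definition path_numbering P (k : nat) (u : nat -> T) : Prop :=
  [/\ (0 < k)%N,
      forall i j, (i <= k)%N -> (j <= k)%N -> u i = u j -> i = j,
      vset P = [set u i | i in [set i | (i <= k)%N]]
    & eset P = [set [set u i; u i.+1] | i in [set i | (i < k)%N]]].

Definition is_path P : Prop := exists k u, path_numbering P k u.

Definition be_path A B P : Prop :=
  [/\ is_path P,
      vset P `<=` A `|` B
    & exists! e, [/\ eset P e, e `&` A !=set0 & e `&` B !=set0]].

Definition path_bipartite A B G : Prop :=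
  (A `<=` vset G /\ B `<=` vset G) /\
  exists F : set (graph T),
    [/\ F !=set0,
        F `<=` be_path A B,
        vset G = \bigcup_(P in F) vset P
      & eset G = \bigcup_(P in F) eset P].

End Graphs.

(* Main.v *)
(** A be-path meets the crossing edge [{a0, b0}] once, so it consists of a path
    inside [A] ending at [a0] followed by a path inside [B] starting at [b0].
    Hence every vertex of a path-bipartite graph reaches, inside its own part,
    an endpoint of a crossing edge.  Conversely, such paths extended by the
    crossing edge are be-paths, and they cover an edge [{x, y}] of [G[A]]: take
    a path from [x]; if it avoids [y], prepend [y], otherwise prepend [x] to its
    tail from [y].  In the proximity graph the crossing edges are exactly the
    pairs at distance [dist(A, B)]. *)
Require Import Defs.
From mathcomp Require Import all_boot all_order all_algebra.
From mathcomp Require Import all_classical all_reals.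

Set Implicit Arguments.
Unset Strict Implicit.
Unset Printing Implicit Defensive.

Import Order.TTheory GRing.Theory Num.Theory.

Local Open Scope classical_set_scope.
Local Open Scope ring_scope.

(** * Paths given by injective numberings, and simple walks *)

Section Walks.
Context {T : Type}.
Implicit Types (G P : graph T) (A B S : set T) (u : nat -> T).

(** Injectivity makes consecutive vertices distinct, which is what the field [eset_pair] asks of
    every edge. *)
Lemma path_numbering_exists k u : (0 < k)%N ->
    (forall i j, (i <= k)%N -> (j <= k)%N -> u i = u j -> i = j) ->
  exists P, path_numbering P k u.
Proof.
move=> k0 uI.
pose V := [set u i | i in [set i | (i <= k)%N]].
pose E := [set [set u i; u i.+1] | i in [set i | (i < k)%N]].
suff VE e : E e -> exists x y, [/\ V x, V y, x <> y & e = [set x; y]].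
  by exists (Graph VE); split.
move=> [i /= ik <-]; exists (u i), (u i.+1); split => //.
- by exists i => //=; exact: ltnW.
- by exists i.+1.
- by move/(uI _ _ (ltnW ik) ik) => /n_Sn.
Qed.

(** Reversal turns edge number [i] into edge number [k - i.+1] with its endpoints exchanged. *)
Lemma path_numbering_rev P k u :
  path_numbering P k u -> path_numbering P k (fun i => u (k - i)%N).
Proof.
move=> [k0 uI VP EP]; split => //.
- move=> i j ik jk /uI; rewrite !leq_subr => /(_ isT isT) ij.
  by rewrite -(subKn ik) ij subKn.
- rewrite VP; apply/seteqP; split => [_ [i /= ik <-]|_ [i /= ik <-]].
    by exists (k - i)%N; rewrite /= ?leq_subr// subKn.
  by exists (k - i)%N; rewrite /= ?leq_subr.
- rewrite EP; apply/seteqP; split => [_ [i /= ik <-]|_ [i /= ik <-]].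
    exists (k - i.+1)%N; first by rewrite /= -subSn// subSS leq_subr.
    by rewrite subKn// -subSn// subSS subKn 1?ltnW// setUC.
  exists (k - i.+1)%N; first by rewrite /= -subSn// subSS leq_subr.
  by rewrite -subSn// subSS setUC.
Qed.

(* Unlike a path, a walk may be reduced to the single vertex [u 0]. *)
Definition simple_walk G S k u :=
  [/\ forall i, (i <= k)%N -> S (u i),
      forall i j, (i <= k)%N -> (j <= k)%N -> u i = u j -> i = j
    & forall i, (i < k)%N -> eset G [set u i; u i.+1]].

(** The case [k = 0] is allowed: then [a] itself is joined to a vertex of [B]. *)
Definition reaches G A B a := exists k u b,
  [/\ simple_walk G A k u, u 0%N = a, B b & eset G [set u k; b]].

Lemma simple_walk_drop G S k u i : (i <= k)%N ->
  simple_walk G S k u -> simple_walk G S (k - i) (fun j => u (i + j)%N).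
Proof.
move=> ik [uS uI uE]; have le j : (j <= k - i)%N -> (i + j <= k)%N.
  by move=> jk; rewrite -(subnKC ik) leq_add2l.
split => [j /le /uS //|j l /le jk /le lk /(uI _ _ jk lk)/addnI//|j jk].
by rewrite addnS; apply: uE; rewrite -addnS; exact: le.
Qed.

Lemma simple_walk_cons G S k u x : S x -> eset G [set x; u 0%N] ->
    (forall i, (i <= k)%N -> u i <> x) ->
  simple_walk G S k u -> simple_walk G S k.+1 (fun i => if i is j.+1 then u j else x).
Proof.
move=> Sx xu ux [uS uI uE]; split => [[|i]//|[|i] [|j]//|[|i]//].
- exact: uS.
- by move=> _ jk /esym/ux; case/(_ jk).
- by move=> ik _ /ux; case/(_ ik).
- by move=> ik jk /uI ->.
- exact: uE.
Qed.

Lemma simple_walk_rcons G S k u b : S b -> eset G [set u k; b] ->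
    (forall i, (i <= k)%N -> u i <> b) ->
  simple_walk G S k u ->
  simple_walk G S k.+1 (fun i => if (i <= k)%N then u i else b).
Proof.
move=> Sb ub uNb [uS uI uE]; split.
- by move=> i _; case: ifP => // /uS.
- move=> i j; case: ifPn => [ik _|]; case: ifPn => [jk _|].
  + exact: uI.
  + by move=> _ _ /uNb; case/(_ ik).
  + by move=> _ _ /esym/uNb; case/(_ jk).
  + rewrite -!ltnNge => kj ki ik jk _; apply/eqP.
    by rewrite eqn_leq (leq_trans ik kj) (leq_trans jk ki).
- move=> i ik; rewrite -ltnS ik; case: ifP => [|/negbT]; first exact: uE.
  by rewrite -leqNgt => ki; have -> : i = k by apply/eqP; rewrite eqn_leq ki -ltnS ik.
Qed.

Lemma path_numbering_simple_walk G S P k u :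
    path_numbering P k u -> subgraph P G -> vset P `<=` S ->
  simple_walk G S k u.
Proof.
move=> [_ uI VP EP] [_ PE] PS; split => // i ik.
- by apply: PS; rewrite VP; exists i.
- by apply: PE; rewrite EP; exists i.
Qed.

Lemma simple_walk_subgraph G S P k u :
    path_numbering P k u -> simple_walk G S k u -> S `<=` vset G ->
  subgraph P (induced G S).
Proof.
move=> [_ _ VP EP] [uS _ uE] SG; split => [|e].
  by rewrite VP => _ [i /= ik <-]; split; [apply: SG|]; exact: uS.
rewrite EP => -[i /= ik <-]; split; first exact: uE.
by move=> x [->|->]; apply: uS => //; exact: ltnW.
Qed.

(** This symmetry lets the lemmas proved for walks in [A] serve for walks in [B] as well. *)
Lemma be_pathC A B : be_path A B = be_path B A.
Proof.
rewrite /be_path; apply/funext => P; apply/propext.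
by split=> -[PP PAB [e [[Pe e1 e2] eU]]]; (split => //; [by rewrite setUC|]);
  exists e; (split => // f [Pf f1 f2]); apply: eU.
Qed.

End Walks.

(** * Path-bipartiteness as reachability of crossing edges *)

Section PathBipartite.
Context {T : Type} (G : graph T).
Implicit Types (A B : set T) (P : graph T) (u : nat -> T).

Lemma be_path_reaches A B P a : A `&` B = set0 ->
  be_path A B P -> subgraph P G -> A a -> vset P a -> reaches G A B a.
Proof.
move=> AB [[k [u Pu]] PAB [e [[Pe eA eB] eU]]] PG Aa Pa.
have AnB x : A x -> ~ B x by move=> Ax Bx; rewrite -[False]/(set0 x) -AB.
(* Up to reversal of the path, [a] comes no later than the crossing edge, so one can walk forward
   from [a] to that edge. *)
have [i [j [v [Pv ij jk vi ev]]]] : exists i j v, [/\ path_numbering P k v,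
    (i <= j)%N, (j < k)%N, v i = a & e = [set v j; v j.+1]].
  have [_ _ VP EP] := Pu.
  move: Pa Pe; rewrite VP EP => -[i /= ik ui] [j /= jk ej].
  have [ij|ji] := leqP i j; first by exists i, j, u.
  exists (k - i)%N, (k - j.+1)%N, (fun i => u (k - i)%N).
  split; first exact: path_numbering_rev.
  - exact: leq_sub2l.
  - by rewrite -subSn// subSS leq_subr.
  - by rewrite subKn.
  - by rewrite subKn// -subSn// subSS subKn 1?ltnW// setUC.
have [_ vI VP EP] := Pv.
(* The walk cannot enter [B] before index [j]: the first step into [B] would be a crossing edge,
   hence [e] by uniqueness, and injectivity excludes this because its first index is below [j]. *)
have vA m : (i + m <= j)%N -> A (v (i + m)%N).
  elim: m => [|m IH]; first by rewrite addn0 vi.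
  rewrite addnS => imj; have Am := IH (ltnW imj).
  have imk : (i + m < k)%N := leq_trans imj (ltnW jk).
  have : vset P (v (i + m).+1) by rewrite VP; exists (i + m).+1.
  case/PAB => // Bm.
  have : [set v j; v j.+1] (v (i + m)%N).
    rewrite -ev (eU [set v (i + m)%N; v (i + m).+1]); first by left.
    split; first by rewrite EP; exists (i + m)%N.
    - by exists (v (i + m)%N); split=> //; left.
    - by exists (v (i + m).+1); split=> //; right.
  case=> /vI => [/(_ (ltnW imk) (ltnW jk))|/(_ (ltnW imk) jk)] E.
    by rewrite E ltnn in imj.
  by rewrite E ltnNge leqnSn in imj.
exists (j - i)%N, (fun l => v (i + l)%N), (v j.+1); split.
- split.
  + by move=> l lj; apply: vA; rewrite -(subnKC ij) leq_add2l.
  + move=> l m lj mj /vI.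
    have le n : (n <= j - i)%N -> (i + n <= k)%N.
      by move=> nj; apply: leq_trans (ltnW jk); rewrite -(subnKC ij) leq_add2l.
    by move=> /(_ (le _ lj) (le _ mj))/addnI.
  + move=> l lj; rewrite addnS; apply: PG.2; rewrite EP.
    exists (i + l)%N => //=; apply: leq_trans (ltnW jk).
    by rewrite -addnS -(subnKC ij) leq_add2l.
- by rewrite addn0.
(* Since [v j] lies in [A], the vertex in which [e] meets [B] must be [v j.+1]. *)
- have := vA (j - i)%N; rewrite subnKC// => /(_ (leqnn _)) Aj.
  by case: eB => x []; rewrite ev => -[->|->]// /(AnB _ Aj).
- by rewrite subnKC// -ev; exact: PG.2.
Qed.

(** In the walk extended by [b], the only vertex in [B] is the last one, so only the last edge
    crosses. The final three clauses record which edges and vertices the be-path covers. *)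
Lemma reaches_be_path A B k u b : A `&` B = set0 -> A `|` B `<=` vset G ->
    simple_walk G A k u -> B b -> eset G [set u k; b] ->
  exists P, [/\ be_path A B P, subgraph P G,
    eset P [set u k; b], forall i, (i <= k)%N -> vset P (u i)
  & forall i, (i < k)%N -> eset P [set u i; u i.+1]].
Proof.
move=> AB ABG uw Bb ub; have [uA uI uE] := uw.
have AnB x : A x -> ~ B x by move=> Ax Bx; rewrite -[False]/(set0 x) -AB.
pose v i := if (i <= k)%N then u i else b.
have vu i : (i <= k)%N -> v i = u i by rewrite /v => ->.
have vk : v k.+1 = b by rewrite /v ltnn.
have vw : simple_walk G (A `|` B) k.+1 v.
  apply: simple_walk_rcons => //.
  - by right.
  - by move=> i /uA/AnB + ui; rewrite ui.
  - by split => // i /uA; left.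
have [vAB vI vE] := vw.
have [P Pv] := @path_numbering_exists _ k.+1 v isT vI.
have [_ _ VP EP] := Pv.
have [PV PE] := simple_walk_subgraph Pv vw ABG.
exists P; split.
- split; first by exists k.+1, v.
    by move=> x /PV[].
  exists [set u k; b]; split.
    split.
    + by rewrite EP; exists k => //=; rewrite vu// vk.
    + by exists (u k); split; [left|exact: uA].
    + by exists b; split => //; right.
  move=> f []; rewrite EP => -[i /= ik <-] _ [x [xi Bx]].
  rewrite vu// in xi *.
  have [ki|ki] := eqVneq i k; first by rewrite ki vk.
  have {ki}ik : (i < k)%N by rewrite ltn_neqAle ki -ltnS.
  by move: xi; rewrite vu// => -[] xi; case: (AnB x) => //; rewrite xi;
    apply: uA => //; exact: ltnW.
- by split => x; [move=> /PV[]|move=> /PE[]].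
- by rewrite EP; exists k => //=; rewrite vu// vk.
- by move=> i ik; rewrite VP; exists i; rewrite ?vu//= ltnW.
- by move=> i ik; rewrite EP; exists i; rewrite ?vu//= 1?ltnW// ltnW.
Qed.

Lemma reaches_edge_be_path A B x y : A `&` B = set0 -> A `|` B `<=` vset G ->
    A x -> A y -> x <> y -> eset G [set x; y] -> reaches G A B x ->
  exists P, [/\ be_path A B P, subgraph P G & eset P [set x; y]].
Proof.
move=> AB ABG Ax Ay xy Gxy [k [u [b [uw u0 Bb ub]]]].
have [_ uI _] := uw.
have [[i ik ui]|yN] := pselect (exists2 i, (i <= k)%N & u i = y).
  (* As [u 0] is [x], the tail from [y] starts at a positive index and, by injectivity, avoids [x];
     prepending [x] keeps it simple. *)
  have i0 : (0 < i)%N by case: i ui ik => // /esym; rewrite u0 => /esym.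
  have vw := simple_walk_cons Ax _ _ (simple_walk_drop ik uw).
  have [] := @reaches_be_path A B _ _ b AB ABG (vw _ _) Bb.
  - by rewrite addn0 ui.
  - move=> j jk; rewrite -u0 => uij; have ijk : (i + j <= k)%N by rewrite -(subnKC ik) leq_add2l.
    by have /eqP := uI _ 0%N ijk isT uij; rewrite addn_eq0 eqn0Ngt i0.
  - by rewrite subnKC.
  - move=> P [PAB PG _ _ PE]; exists P; split => //.
    by have := PE 0%N isT; rewrite addn0 ui.
(* Here [y] is not on the walk and can be put in front of it; the new first edge is [[set y; x]]. *)
have vw : simple_walk G A k.+1 (fun i => if i is j.+1 then u j else y).
  apply: simple_walk_cons => //; first by rewrite u0 setUC.
  by move=> i ik ui; apply: yN; exists i.
have [P [PAB PG _ _ PE]] := reaches_be_path AB ABG vw Bb ub.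
by exists P; split => //; have := PE 0%N isT; rewrite u0 setUC.
Qed.

Lemma path_bipartite_reaches A B : A `&` B = set0 -> A !=set0 ->
    vset G = A `|` B ->
  path_bipartite A B G <->
  (forall a, A a -> reaches G A B a) /\ (forall b, B b -> reaches G B A b).
Proof.
move=> AB [a0 Aa0] VG.
have BA : B `&` A = set0 by rewrite setIC.
have ABG : A `|` B `<=` vset G by rewrite VG.
have BAG : B `|` A `<=` vset G by rewrite setUC.
split.
  move=> [_ [F [_ FP FV FE]]].
  have FG P : F P -> subgraph P G.
    by move=> PF; split => x Px; rewrite ?FV ?FE; exists P.
  split=> x xS.
    have : vset G x by apply: ABG; left.
    rewrite FV => -[P PF Px].
    exact: (be_path_reaches AB (FP _ PF) (FG _ PF) xS Px).
  have : vset G x by apply: ABG; right.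
  rewrite FV => -[P PF Px].
  by apply: (be_path_reaches BA _ (FG _ PF) xS Px); rewrite be_pathC; exact: FP.
move=> [rA rB]; split; first by rewrite VG; split=> x; [left|right].
have vert x : vset G x ->
    exists2 P, be_path A B P /\ subgraph P G & vset P x.
  rewrite VG => -[xA|xB].
    have [k [u [b [uw <- Bb ub]]]] := rA _ xA.
    by have [P [? ? _ PV _]] := reaches_be_path AB ABG uw Bb ub; exists P => //; apply: PV.
  have [k [u [b [uw <- Bb ub]]]] := rB _ xB.
  have [P []] := reaches_be_path BA BAG uw Bb ub; rewrite be_pathC => ? ? _ PV _.
  by exists P => //; apply: PV.
have cross x y : A x -> B y -> eset G [set x; y] ->
    exists2 P, be_path A B P /\ subgraph P G & eset P [set x; y].
  move=> Ax By Gxy.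
  (* A crossing edge is itself a be-path, obtained from the one-vertex walk at [x]. *)
  have uw : simple_walk G A 0 (fun=> x) by split => // -[|i] [|j].
  have [P [? ? ? _ _]] := reaches_be_path AB ABG uw By Gxy.
  by exists P.
have edge e : eset G e ->
    exists2 P, be_path A B P /\ subgraph P G & eset P e.
  move=> Ge; have [x [y [Gx Gy xy eE]]] := eset_pair Ge; rewrite {}eE in Ge *.
  move: Gx Gy; rewrite VG => -[Ax|Bx] [Ay|By].
  - have [P [? ? ?]] := reaches_edge_be_path AB ABG Ax Ay xy Ge (rA _ Ax).
    by exists P.
  - exact: cross.
  - by rewrite setUC; apply: cross => //; rewrite setUC.
  - have [P []] := reaches_edge_be_path BA BAG Bx By xy Ge (rB _ Bx).
    by rewrite be_pathC => ? ? ?; exists P.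
(* The family of all be-paths contained in [G] has its union inside [G] by construction; [vert] and
   [edge] give the reverse inclusions. *)
exists [set P | be_path A B P /\ subgraph P G]; split.
- by have [P PG _] := vert a0 (ABG _ (or_introl Aa0)); exists P.
- by move=> P [].
- apply/seteqP; split => [x /vert//|x [P [_ [PG _]]]]; exact: PG.
- apply/seteqP; split => [x /edge//|x [P [_ [_ PG]]]]; exact: PG.
Qed.

End PathBipartite.

(** * Crossing edges and best proximity pairs in the proximity graph *)

Section Proximity.
Context {R : realType} {X : Type} (d : X -> X -> R).
Hypothesis hd : is_semimetric d.
Implicit Types A B : set X.

Lemma set_distC A B : set_dist d A B = set_dist d B A.
Proof.
case: hd => _ dC _; congr inf; apply/seteqP.
by split=> _ [x xS [y yS <-]]; exists y => //; exists x.
Qed.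

Lemma prox_rightE A B : prox_right d A B = prox_left d B A.
Proof.
case: hd => _ dC _; apply/seteqP.
by split=> x [xS [y yS xy]]; split=> //; exists y => //; rewrite dC xy set_distC.
Qed.

Lemma best_proximity_pairC A B a b :
  best_proximity_pair d A B a b -> best_proximity_pair d B A b a.
Proof.
case: (hd) => _ dC _ [Aa Bb ab]; split; last by rewrite dC set_distC.
  by rewrite -prox_rightE.
by rewrite prox_rightE.
Qed.

Lemma set_dist_le A B a b : A a -> B b -> set_dist d A B <= d a b.
Proof.
case: hd => d0 _ _ Aa Bb; apply: ge_inf; last by exists a => //; exists b.
by exists 0 => _ [x _ [y _ <-]].
Qed.

Variables (A B : set X) (G : graph X).
Hypothesis AB : A `&` B = set0.
Hypothesis hV : vset G = [set: X].
Hypothesis hE : forall x y, x <> y ->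
  (eset G [set x; y] <-> d x y <= set_dist d A B).

Lemma crossing_edgeE a b : A a -> B b ->
  eset G [set a; b] <-> d a b = set_dist d A B.
Proof.
move=> Aa Bb; have ab : a <> b.
  by move=> ab; rewrite -[False]/(set0 a) -AB; split=> //; rewrite ab.
split=> [/(hE ab) le|ab']; last by apply/hE; rewrite ?ab'.
by apply/eqP; rewrite eq_le le set_dist_le.
Qed.

Lemma reaches_best_proximity :
  (forall a, A a -> reaches G A B a) <->
  (forall a, (A `\` prox_left d A B) a ->
     exists (a' b' : X) (P : graph X) (k : nat) (u : nat -> X),
       [/\ best_proximity_pair d A B a' b', path_numbering P k u,
           subgraph P (induced G A), u 0%N = a & u k = a']).
Proof.
split=> [rA a [Aa Na]|pA a Aa].
  have [k [u [b [uw u0 Bb ub]]]] := rA a Aa.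
  have [uA uI _] := uw; have Auk := uA _ (leqnn k).
  have {}ub := (crossing_edgeE Auk Bb).1 ub.
  have k0 : (0 < k)%N.
    by case: k u0 ub {uw uA uI Auk} => // -> ab; case: Na; split=> //; exists b.
  have [P Pu] := path_numbering_exists k0 uI.
  exists (u k), b, P, k, u; split => //.
    by split => //; split => //; [exists b|exists (u k)].
  by apply: simple_walk_subgraph Pu uw _; rewrite hV.
have [[_ [b Bb ab]]|Na] := pselect (prox_left d A B a).
  exists 0%N, (fun=> a), b; split => //; last by apply/crossing_edgeE.
  by split => // -[|i] [|j].
have [a' [b [P [k [u [[[Aa' _] [Bb _] ab] Pu [PV PE] u0 uk]]]]]] := pA a (conj Aa Na).
exists k, u, b; split => //.
  apply: path_numbering_simple_walk Pu _ _; last by move=> x /PV[].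
  by split => x; [move=> /PV[]|move=> /PE[]].
by rewrite uk; apply/crossing_edgeE.
Qed.

End Proximity.

Theorem theorem3p1 (R : realType) (X : Type) (X0 : [set: X] !=set0)
    (d : X -> X -> R) (hd : is_semimetric d)
    (A B : set X) (hAB : A `&` B = set0)
    (hA : proximinal d A) (hB : proximinal d B)
    (hX : [set: X] = A `|` B)
    (G : graph X) (hV : vset G = [set: X])
    (hE : forall x y : X, x <> y ->
       (eset G [set x; y] <-> d x y <= set_dist d A B)) :
  path_bipartite A B G <->
  (forall a : X, (A `\` prox_left d A B) a ->
     exists (a' b' : X) (P : graph X) (k : nat) (u : nat -> X),
       [/\ best_proximity_pair d A B a' b',
           path_numbering P k u,
           subgraph P (induced G A),
           u 0%N = a
         & u k = a']) /\
  (forall b : X, (B `\` prox_right d A B) b ->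
     exists (a' b' : X) (P : graph X) (k : nat) (u : nat -> X),
       [/\ best_proximity_pair d A B a' b',
           path_numbering P k u,
           subgraph P (induced G B),
           u 0%N = b
         & u k = b']).
Proof.
have VG : vset G = A `|` B by rewrite hV.
have hE' x y : x <> y -> (eset G [set x; y] <-> d x y <= set_dist d B A).
  by rewrite -(set_distC hd); exact: hE.
have BA : B `&` A = set0 by rewrite setIC.
rewrite (path_bipartite_reaches hAB hA.1 VG).
rewrite (reaches_best_proximity hd hAB hV hE) (reaches_best_proximity hd BA hV hE').
rewrite (prox_rightE hd).
by split=> -[pA pB]; split=> // b /pB[x [y [P [k [u [pr Pu PG u0 uk]]]]]];
  exists y, x, P, k, u; split => //;
  exact: best_proximity_pairC.
Qed.
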